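(* Let $t_{n,i}$ be the number of partitions $\lambda\vdash n$ with $\mathrm{bump}(\lambda)=i$. For all $n,j\ge0$, $t_{n+j,n}\le t_{n+j+1,n}$. Also, for $i\in\{0,1,\ldots,\lfloor n/2\rfloor\}$, $$t_{n,i}=[z^i]\ \frac{1}{\prod_{k\ge2}\left(1-z^{\binom{k}{2}}\right)}.$$
   Context: For a partition $\lambda=(\lambda_1,\lambda_2,\ldots)$ (weakly decreasing parts), $\mathrm{bump}(\lambda)=\sum_{i\ge1}(i-1)\lambda_i$; this is the number of bumps in the Robinson–Schensted procedure applied to any permutation whose tableaux have shape $\lambda$. $[z^i]F$ denotes the coefficient of $z^i$ in the formal power series $F$. *)

(* Defs.v *)
From HB Require Import structures.
From mathcomp Require Import all_boot all_order all_algebra.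
From mathcomp Require Import boolp classical_sets.
From mathcomp Require Import zify.

Set Implicit Arguments.
Unset Strict Implicit.
Unset Printing Implicit Defensive.

Import GRing.Theory.

Local Open Scope ring_scope.

Definition is_intpart (n : nat) (s : seq nat) : bool :=
  [&& sorted geq s, 0%N \notin s & sumn s == n].

(* Parts are indexed from 0 here, hence the weight i in place of i - 1. *)
Definition bump (s : seq nat) : nat := (\sum_(i < size s) i * nth 0 s i)%N.

(* A partition of n has at most n parts, each at most n, so that the finite
   type n.-bseq 'I_n.+1 contains all of them (is_intpart_bseq below). *)
Definition bump_count (n i : nat) : nat :=
  #|[pred s : n.-bseq 'I_n.+1 |
      is_intpart n (map val s) & bump (map val s) == i]|.

Lemma is_intpart_bseq (n : nat) (s : seq nat) :
  is_intpart n s -> exists! b : n.-bseq 'I_n.+1, map val b = s.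
Proof.
case/and3P=> _ s0 /eqP sn.
have les : all (fun x => x < n.+1)%N s.
  apply/allP=> x xs; rewrite ltnS -sn.
  elim: s xs {s0 sn} => //= y s IH; rewrite inE => /predU1P[->|/IH h].
    exact: leq_addr.
  exact: leq_trans h (leq_addl _ _).
have szs : (size s <= n)%N.
  rewrite -sn; elim: s s0 {sn les} => //= y s IH.
  rewrite inE negb_or eq_sym -lt0n => /andP[y0 /IH h].
  by rewrite -add1n leq_add.
have ms : map val (pmap (insub : nat -> option 'I_n.+1) s) = s.
  elim: s les {s0 sn szs} => //= x s IH /andP[xn /IH h].
  by rewrite insubT /= h.
have szp : (size (pmap (insub : nat -> option 'I_n.+1) s) <= n)%N.
  by rewrite -(size_map val) ms.
exists (Bseq szp); split=> // b bs; apply: val_inj.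
by apply: (inj_map val_inj); rewrite /= bs ms.
Qed.

(* A formal power series over the integers is its sequence of coefficients:
   f i = [z^i] f. *)
Definition fps := nat -> int.

Definition fps_one : fps := fun i => (i == 0%N)%:R.

Definition fps_mul (f g : fps) : fps :=
  fun i => \sum_(k < i.+1) f k * g (i - k)%N.

(* The reciprocal 1 / f. *)
Definition fps_inv (f : fps) : fps :=
  xget (fun=> 0) [set g : fps | fps_mul f g = fps_one].

(* \prod_(k >= m) u k, as the coefficientwise limit of its partial products. *)
Definition fps_prod (m : nat) (u : nat -> {poly int}) : fps :=
  fun i => xget 0 [set c : int | exists N : nat, forall M : nat,
    (N <= M)%N -> (\prod_(m <= k < M) u k)`_i = c].

Lemma fps_prodE (m : nat) (u : nat -> {poly int}) (i N : nat) (c : int) :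
  (forall M : nat, (N <= M)%N -> (\prod_(m <= k < M) u k)`_i = c) ->
  fps_prod m u i = c.
Proof.
move=> uc; rewrite /fps_prod; case: xgetP => [d -> [N' ud]|/(_ c)[]]; last first.
  by exists N.
by rewrite -(ud (maxn N N')) ?leq_maxr // uc ?leq_maxl.
Qed.

Lemma bump_prod_coefE (i : nat) :
  fps_prod 2 (fun k => 1 - 'X^('C(k, 2))) i =
  (\prod_(2 <= k < i.+2) (1 - 'X^('C(k, 2))) : {poly int})`_i.
Proof.
apply: (fps_prodE (N := i.+2)) => M /subnKC <-.
elim: (M - i.+2)%N => [|d IH]; first by rewrite addn0.
rewrite addnS big_nat_recr ?leq_addr //= mulrBr mulr1 coefB coefMXn IH.
suff -> : (i < 'C(i.+2 + d, 2))%N by rewrite subr0.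
by rewrite addSn binS bin1 addSn -addSnnS; lia.
Qed.

Lemma fps_mul_recl (f g : fps) (i : nat) :
  fps_mul f g i = f 0%N * g i + \sum_(k < i) f k.+1 * g (i - k.+1)%N.
Proof. by rewrite /fps_mul big_ord_recl subn0. Qed.

Lemma fps_mul_inj (f g h : fps) :
  f 0%N = 1 -> fps_mul f g = fps_mul f h -> g = h.
Proof.
move=> f0 fgh; apply: funext => i; elim/ltn_ind: i => i IH.
move: (congr1 (fun F => F i) fgh); rewrite !fps_mul_recl f0 !mul1r.
suff -> : \sum_(k < i) f k.+1 * g (i - k.+1)%N =
          \sum_(k < i) f k.+1 * h (i - k.+1)%N by move/addIr.
by apply: eq_bigr => k _; rewrite IH //; have := ltn_ord k; lia.
Qed.

Lemma fps_mulV (f : fps) : f 0%N = 1 -> fps_mul f (fps_inv f) = fps_one.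
Proof.
move=> f0; rewrite /fps_inv; case: xgetP => // noinv; exfalso.
pose step (l : seq int) : seq int := rcons l ((size l == 0)%:R -
  \sum_(k < size l) f k.+1 * nth 0 l (size l - k.+1)).
pose L n := iter n step [::].
have szL n : size (L n) = n by elim: n => //= n IH; rewrite size_rcons IH.
pose g : fps := fun n => nth 0 (L n.+1) n.
have nthL n k : (k < n)%N -> nth 0 (L n) k = g k.
  elim: n => // n IH; rewrite ltnS leq_eqVlt => /predU1P[-> //|kn].
  by rewrite [L n.+1]/= nth_rcons szL kn IH.
apply: (noinv g); apply: funext => i; rewrite fps_mul_recl f0 mul1r {1}/g.
rewrite [L i.+1]/= nth_rcons szL ltnn eqxx.
rewrite [X in _ - X + _](_ : _ = \sum_(k < i) f k.+1 * g (i - k.+1)%N) ?subrK //.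
by apply: eq_bigr => k _; rewrite nthL //; have := ltn_ord k; lia.
Qed.

Lemma bump_prod0 : fps_prod 2 (fun k => 1 - 'X^('C(k, 2))) 0 = 1.
Proof. by rewrite bump_prod_coefE big_geq // coef1. Qed.

(* Main.v *)
Require Import Defs.
From mathcomp Require Import all_boot all_order all_algebra.
From mathcomp Require Import boolp.
From mathcomp Require Import zify.

Import GRing.Theory.

Set Implicit Arguments.
Unset Strict Implicit.
Unset Printing Implicit Defensive.

Local Open Scope ring_scope.

(* The short name would otherwise denote the index shift on ordinals. *)
Local Notation bump := Defs.bump.

(** Allow zero parts, so that a partition of [n] becomes a weakly decreasing
    sequence of any fixed length [h >= n]. Adding 1 to the first part does not
    change the bump, because that part has weight 0; this injection gives the
    inequality ([padded_count_monotone]).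

    For the second claim, cut the Young diagram into columns: a column of
    height [k] contributes [k] to the size and [0 + 1 + ... + (k - 1)], which
    is ['C(k, 2)], to the bump. Splitting on whether there is a column of full
    height [h + 1] gives the recurrence [padded_count_rec] in [h]. Columns of
    height 1 are free for the bump, and a column of height [k >= 2] satisfies
    [k <= 2 * 'C(k, 2)], so a multiset of such columns of total bump [i] has at
    most [2 * i] cells. Hence, as soon as [2 * i <= n], the columns of height at
    least 2 can be chosen arbitrarily and completed with columns of height 1 in
    exactly one way: the count no longer depends on [n]
    ([padded_count_stable]). The recurrence for this stable count says that
    multiplying its generating series by [1 - 'X^('C(h + 1, 2))] removes the
    columns of height [h + 1]; doing this for every height leaves 1, so the
    generating series is the reciprocal of the product. *)

(** * Partitions padded with zeros *)

Definition padded (h n i : nat) (s : seq nat) : bool :=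
  [&& size s == h, sorted geq s, sumn s == n & bump s == i].

Definition padded_seq (h n i : nat) : seq (seq nat) :=
  [seq map val (tval t) |
     t <- enum [pred t : h.-tuple 'I_n.+1 | padded h n i (map val t)]].

Definition padded_count (h n i : nat) : nat := size (padded_seq h n i).

Lemma leq_sumn (s : seq nat) (x : nat) : x \in s -> (x <= sumn s)%N.
Proof.
elim: s => //= y s IH; rewrite inE => /predU1P[->|/IH h]; first exact: leq_addr.
exact: leq_trans h (leq_addl _ _).
Qed.

Lemma padded_seq_uniq h n i : uniq (padded_seq h n i).
Proof.
rewrite map_inj_uniq ?enum_uniq // => t u /(inj_map val_inj).
exact: val_inj.
Qed.

Lemma mem_padded_seq h n i s : (s \in padded_seq h n i) = padded h n i s.
Proof.
apply/mapP/idP => [[t]|ps]; first by rewrite mem_enum inE => pt ->.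
have /and4P[/eqP szs _ /eqP sums _] := ps.
have ms : map val (map (inord : nat -> 'I_n.+1) s) = s.
  rewrite -map_comp -[RHS]map_id; apply/eq_in_map => x xs /=.
  by rewrite inordK // ltnS -sums leq_sumn.
have sz : size (map (inord : nat -> 'I_n.+1) s) == h by rewrite size_map szs.
by exists (Tuple sz); rewrite ?mem_enum ?inE /= ms.
Qed.

Lemma bump_cons x s : bump (x :: s) = (sumn s + bump s)%N.
Proof.
rewrite /bump big_ord_recl mul0n add0n sumnE (big_nth 0) big_mkord -big_split /=.
by apply: eq_bigr => j _; rewrite /bump /= mulSn.
Qed.

Lemma bump_nil : bump [::] = 0%N.
Proof. by rewrite /bump big_ord0. Qed.

Lemma bump_cat_zeros s k : bump (s ++ nseq k 0%N) = bump s.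
Proof.
elim: s => [|x s IH] /=; last first.
  by rewrite !bump_cons IH sumn_cat sumn_nseq mul0n addn0.
rewrite bump_nil; elim: k => [|k IH]; first exact: bump_nil.
by rewrite bump_cons sumn_nseq IH.
Qed.

Lemma sumn_mapS s : sumn (map S s) = (sumn s + size s)%N.
Proof. by elim: s => //= x s ->; lia. Qed.

(** The added column of height [size s] has one cell in each row, hence the
    bump [0 + 1 + ... + (size s - 1)]. *)
Lemma bump_mapS s : bump (map S s) = (bump s + 'C(size s, 2))%N.
Proof.
elim: s => [|x s IH]; first by rewrite /= bump_nil.
by rewrite /= !bump_cons IH sumn_mapS binS bin1; lia.
Qed.

Lemma sorted_mapS s : sorted geq (map S s) = sorted geq s.
Proof. by rewrite sorted_map. Qed.

Lemma sorted_cat_zeros s k : sorted geq (s ++ nseq k 0%N) = sorted geq s.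
Proof.
have z : forall j, path geq 0%N (nseq j 0%N) by elim.
case: s => [|x s] /=; first by case: k => //= k; apply: z.
by rewrite cat_path; case: k => [|k] /=; rewrite ?z andbT.
Qed.

(** * The recurrence on the number of rows *)

Lemma padded_rcons0 h n i s : padded h.+1 n i (rcons s 0%N) = padded h n i s.
Proof.
rewrite -[rcons s _]cats1 -[[:: 0%N]]/(nseq 1 0%N) /padded.
by rewrite sorted_cat_zeros bump_cat_zeros size_cat sumn_cat /= addn1 !addn0.
Qed.

Lemma padded_mapS h n i s :
  padded h n i (map S s) =
    [&& h <= n, 'C(h, 2) <= i & padded h (n - h) (i - 'C(h, 2)) s]%N.
Proof.
rewrite /padded size_map sorted_mapS sumn_mapS bump_mapS.
have [<-|] := eqVneq (size s) h; rewrite ?andbF //=.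
by case: (sorted geq s); rewrite ?andbF //=; lia.
Qed.

Lemma sorted_rcons_pos s x :
  sorted geq (rcons s x) -> (0 < x)%N -> all (leq 1) (rcons s x).
Proof.
have geq_trans : transitive geq by move=> a b c ba ac; exact: leq_trans ac ba.
move=> srt x0; rewrite all_rcons x0 /=; apply/allP => y ys.
move: srt; rewrite (sorted_pairwise geq_trans) -cats1 pairwise_cat.
by case/and3P=> /allrelP/(_ y x ys (mem_head _ _)) /= xy _ _; apply: leq_trans xy.
Qed.

(** Either the last row is empty and can be dropped, or some column has full
    height [h + 1] and can be removed by subtracting 1 from every part. *)
Lemma padded_count_rec h n i :
  padded_count h.+1 n i = (padded_count h n i +
    if (h.+1 <= n) && ('C(h.+1, 2) <= i)
    then padded_count h.+1 (n - h.+1) (i - 'C(h.+1, 2)) else 0)%N.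
Proof.
pose full := if (h.+1 <= n)%N && ('C(h.+1, 2) <= i)%N
  then padded_seq h.+1 (n - h.+1) (i - 'C(h.+1, 2)) else [::].
have mem_full s : (map S s \in map (map S) full) = padded h.+1 n i (map S s).
  rewrite (mem_map (inj_map succn_inj)) padded_mapS /full andbA.
  by case: ifP; rewrite // mem_padded_seq.
have zero_notin t : 0%N \notin map S t by apply/mapP => -[].
have perm : perm_eq (padded_seq h.+1 n i)
    (map (rcons^~ 0%N) (padded_seq h n i) ++ map (map S) full).
  apply: uniq_perm; first exact: padded_seq_uniq.
    rewrite cat_uniq map_inj_uniq; last exact: rcons_injl.
    rewrite padded_seq_uniq map_inj_uniq; last exact: inj_map succn_inj.
    rewrite [uniq full](_ : _ = true) ?andbT; last first.
      by rewrite /full; case: ifP; rewrite // padded_seq_uniq.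
    apply/hasPn => _ /mapP[t _ ->]; apply/mapP => -[s _ e].
    by have := zero_notin t; rewrite e mem_rcons mem_head.
  (* A positive last part makes every part positive, so that a full column can
     be removed. *)
  case/lastP=> [|s x]; rewrite mem_cat mem_padded_seq.
    apply/esym/orP => -[/mapP[[|a s] _] //|].
    by rewrite -[[::]]/(map S [::]) mem_full.
  have [->|x0] := eqVneq x 0%N.
    rewrite (mem_map (@rcons_injl _ 0%N)) mem_padded_seq padded_rcons0.
    rewrite [_ \in map _ full](_ : _ = false) ?orbF //.
    apply/mapP => -[t _ e].
    by have := zero_notin t; rewrite -e mem_rcons mem_head.
  rewrite [_ \in map (rcons^~ _) _](_ : _ = false) /=; last first.
    by apply/mapP => -[t _ /rcons_inj[_ /eqP]]; rewrite (negPf x0).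
  have [srt|/negPf nsrt] := boolP (sorted geq (rcons s x)); last first.
    apply/idP/mapP => [/and4P[_]|[t]]; first by rewrite nsrt.
    rewrite /full; case: ifP => // _; rewrite mem_padded_seq => /and4P[_ st _ _].
    by move=> e; rewrite e sorted_mapS st in nsrt.
  suff <- : map S (map predn (rcons s x)) = rcons s x by rewrite mem_full.
  rewrite -map_comp -[RHS]map_id; apply/eq_in_map => y.
  move: x0; rewrite -lt0n => /(sorted_rcons_pos srt)/allP pos /pos.
  exact: prednK.
rewrite /padded_count (perm_size perm) size_cat (size_map (rcons^~ 0%N)).
by rewrite (size_map (map S)) /full; case: ifP.
Qed.

(** Adding 1 to the first part preserves the order of the parts and the bump,
    because the first part has weight 0. The row count is positive so that there
    is a first part, possibly zero. *)
Lemma padded_count_monotone h n i :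
  (padded_count h.+1 n i <= padded_count h.+1 n.+1 i)%N.
Proof.
pose grow (s : seq nat) := (head 0 s).+1 :: behead s.
have grow_inj : {in padded_seq h.+1 n i &, injective grow}.
  move=> [|x s] [|y t]; rewrite !mem_padded_seq // => _ _.
  by rewrite /grow /= => -[-> ->].
rewrite /padded_count -(size_map grow); apply: uniq_leq_size.
  by rewrite map_inj_in_uniq // padded_seq_uniq.
move=> _ /mapP[s + ->]; rewrite !mem_padded_seq.
case: s => // x s /and4P[szs srt sms bps].
rewrite /padded /grow /= bump_cons szs; move: sms bps; rewrite /= bump_cons.
move=> /eqP <- ->; rewrite andbT addSn eqxx andbT /=.
by case: s srt {szs} => //= y s /andP[yx ->]; rewrite andbT; apply: leqW.
Qed.

(** * Partitions as padded sequences *)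

Definition unpad (s : seq nat) : seq nat := [seq x <- s | 0 < x]%N.

(** Sortedness pushes all the zeros to the end. *)
Lemma padded_unpadK s :
  sorted geq s -> unpad s ++ nseq (size s - size (unpad s)) 0%N = s.
Proof.
elim: s => //= x s IH xs; have := IH (path_sorted xs).
case: x xs => [|x] xs /= e; last by rewrite subSS e.
have z : all (pred1 0%N) s.
  have geq_trans : transitive geq by move=> a b c ba ac; exact: leq_trans ac ba.
  have := order_path_min geq_trans xs.
  by apply: sub_all => y /=; rewrite leqn0.
have us : unpad s = [::].
  by rewrite /unpad; elim: s z {IH xs e} => //= y s IH /andP[/eqP -> /IH].
by move: e; rewrite us subn0 /= => ->.
Qed.

Lemma unpad_cat_zeros s k : 0%N \notin s -> unpad (s ++ nseq k 0%N) = s.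
Proof.
move=> s0; rewrite /unpad filter_cat (_ : filter _ (nseq k _) = [::]); last first.
  by elim: k.
rewrite cats0; apply/all_filterP/allP => x xs; rewrite lt0n.
by apply: contraNneq s0 => <-.
Qed.

(** Deleting the zeros is inverse to padding; [h >= n] rows leave room for every
    partition of [n]. *)
Lemma bump_count_padded h n i : (n <= h)%N -> bump_count n i = padded_count h n i.
Proof.
move=> nh; rewrite /padded_count -(size_map unpad) /bump_count cardE.
rewrite -(size_map (fun b : n.-bseq 'I_n.+1 => map val b)).
apply/perm_size/uniq_perm.
- rewrite map_inj_uniq ?enum_uniq // => b c /(inj_map val_inj).
  exact: val_inj.
- rewrite map_inj_in_uniq ?padded_seq_uniq // => s t.
  rewrite !mem_padded_seq => /and4P[/eqP szs srs _ _] /and4P[/eqP szt srt _ _] e.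
  by rewrite -(padded_unpadK srs) -(padded_unpadK srt) e szs szt.
move=> s; apply/mapP/mapP => [[b]|[t]].
  rewrite mem_enum inE => /andP[/and3P[srt s0 sms] bps] ->.
  have szb := size_bseq b.
  exists (map val b ++ nseq (h - size b) 0%N); last by rewrite unpad_cat_zeros.
  rewrite mem_padded_seq /padded size_cat size_map size_nseq.
  rewrite subnKC ?(leq_trans szb) // eqxx sorted_cat_zeros srt bump_cat_zeros.
  by rewrite sumn_cat sumn_nseq mul0n addn0 sms.
rewrite mem_padded_seq => /and4P[_ srt sms bps] ->.
have u0 : 0%N \notin unpad t by rewrite mem_filter.
have tE := padded_unpadK srt.
have pu : is_intpart n (unpad t).
  apply/and3P; split=> //.
    by rewrite -tE sorted_cat_zeros in srt.
  by rewrite -tE sumn_cat sumn_nseq mul0n addn0 in sms.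
have [b [be _]] := is_intpart_bseq pu; exists b => //.
by rewrite -tE bump_cat_zeros in bps; rewrite mem_enum inE be pu.
Qed.

(** * Independence of the size *)

Lemma padded_count0 n i : padded_count 0 n i = ((n == 0) && (i == 0))%N.
Proof.
have e s : (s \in padded_seq 0 n i) = [&& n == 0, i == 0 & s == [::]]%N.
  rewrite mem_padded_seq /padded.
  case: s => [|x s] /=; last by rewrite !andbF.
  by rewrite bump_nil !(eq_sym 0%N) andbT.
have perm : perm_eq (padded_seq 0 n i) (nseq ((n == 0) && (i == 0))%N [::]).
  apply: uniq_perm => [||s]; first exact: padded_seq_uniq.
    by case: (_ && _).
  by rewrite e mem_nseq andbA lt0b.
by rewrite /padded_count (perm_size perm) size_nseq.
Qed.

Lemma padded_count1 n i : padded_count 1 n i = (i == 0%N).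
Proof.
elim: n => [|n IH]; rewrite padded_count_rec padded_count0 /= ?addn0 //.
by rewrite subn1 subn0 IH.
Qed.

(** The hypothesis is inherited by the second term of the recurrence because a
    column of height [k >= 2] has at most [2 * 'C(k, 2)] cells. *)
Lemma padded_count_stable h n m i :
  (2 * i <= n)%N -> (2 * i <= m)%N ->
  padded_count h.+1 n i = padded_count h.+1 m i.
Proof.
elim: h n m i => [|h IHh] n m i; first by rewrite !padded_count1.
elim/ltn_ind: i n m => i IHi n m ni mi.
rewrite padded_count_rec [RHS]padded_count_rec (IHh n m i ni mi); congr (_ + _)%N.
have c2 : (h.+2 <= 2 * 'C(h.+2, 2))%N by rewrite binS bin1; lia.
have [ci|_] := leqP 'C(h.+2, 2) i; last by rewrite !andbF.
rewrite !andbT !ifT; try lia.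
by apply: IHi; lia.
Qed.

Definition stable_count (h i : nat) : nat := padded_count h (2 * i) i.

Lemma stable_count_rec h i :
  stable_count h.+2 i = (stable_count h.+1 i +
    if 'C(h.+2, 2) <= i then stable_count h.+2 (i - 'C(h.+2, 2)) else 0)%N.
Proof.
rewrite /stable_count padded_count_rec; congr (_ + _)%N.
have c2 : (h.+2 <= 2 * 'C(h.+2, 2))%N by rewrite binS bin1; lia.
have [ci|_] := leqP 'C(h.+2, 2) i; last by rewrite andbF.
by rewrite andbT ifT; [apply: padded_count_stable|]; lia.
Qed.

(** * The generating series *)

(** Truncating the generating series at degree [N] lets the cancellation of the
    factors take place between polynomials. *)
Lemma coef_prod_stable_count h N i : (i < N)%N ->
  ((\prod_(2 <= k < h.+2) (1 - 'X^('C(k, 2)))) *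
     \poly_(j < N) (stable_count h.+1 j)%:Z : {poly int})`_i = (i == 0%N)%:R.
Proof.
elim: h i => [|h IH] i iN.
  rewrite big_geq // mul1r coef_poly iN /stable_count padded_count1.
  by case: eqP.
rewrite -IH // big_nat_recr //= -mulrA !coefM; apply: eq_bigr => k _.
have iN0 : (i - k < N)%N by lia.
have iNc : (i - k - 'C(h.+2, 2) < N)%N by lia.
rewrite mulrBl mul1r coefB coefXnM !coef_poly iN0 iNc.
rewrite stable_count_rec ltnNge.
by case: ifP => _ /=; rewrite PoszD (addrK, addr0) ?subr0.
Qed.

(** The factors with [k >= i + 2] have ['C(k, 2) > i], so they leave the
    coefficient of degree [i] unchanged. *)
Lemma coef_fps_bump_prod M i : (i.+2 <= M)%N ->
  fps_prod 2 (fun k => 1 - 'X^('C(k, 2))) i =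
  (\prod_(2 <= k < M) (1 - 'X^('C(k, 2))) : {poly int})`_i.
Proof.
rewrite bump_prod_coefE => /subnKC <-.
elim: (M - i.+2)%N => [|d IH]; first by rewrite addn0.
rewrite IH addnS [in RHS]big_nat_recr ?leq_addr //= mulrBr mulr1 coefB coefMXn.
suff -> : (i < 'C(i.+2 + d, 2))%N by rewrite subr0.
by rewrite addSn binS bin1 addSn -addSnnS; lia.
Qed.

Lemma fps_inv_bump_prod :
  fps_inv (fps_prod 2 (fun k => 1 - 'X^('C(k, 2)))) =
  (fun i => (bump_count (2 * i) i)%:Z).
Proof.
apply: (fps_mul_inj bump_prod0); rewrite (fps_mulV bump_prod0).
apply: funext => i.
(* [2 * i + 1] rows suffice for all coefficients up to degree [i]. *)
rewrite /fps_one -(@coef_prod_stable_count (2 * i) i.+1) //.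
rewrite coefM /fps_mul; apply: eq_bigr => k _.
have := ltn_ord k; rewrite ltnS => ki.
rewrite (@coef_fps_bump_prod (2 * i).+2); last by lia.
rewrite coef_poly ltnS leq_subr /stable_count -bump_count_padded //; lia.
Qed.

Theorem theorem28 :
  (forall n j : nat,
     (bump_count (n + j) n <= bump_count (n + j + 1) n)%N) /\
  (forall n i : nat, (i <= n %/ 2)%N ->
     (bump_count n i)%:Z =
       fps_inv (fps_prod 2 (fun k : nat => 1 - 'X^('C(k, 2)))) i).
Proof.
split=> [n j|n i ni].
  rewrite !(@bump_count_padded (n + j + 1)); try lia.
  by rewrite addn1 padded_count_monotone.
(* A common number of rows, large enough for partitions of [n] and [2 * i]. *)
rewrite fps_inv_bump_prod !(@bump_count_padded (n + 2 * i).+1); try lia.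
by congr Posz; apply: padded_count_stable; lia.
Qed.
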